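(* Let $\phi=\frac{1+\sqrt5}{2}$. In the Euclidean plane perform the following construction. (1) Let $\triangle ABC$ be a Kepler triangle with $BC=1$ and $AB=\sqrt{\phi}$ (so the right angle is at $B$). (2) Construct a square $ABDE$ (vertices in this cyclic order) externally on the side $AB$, i.e. on the side of line $AB$ not containing $C$. (3) Draw an arc with center $B$ and radius $BE$, cutting the extension of $BA$ beyond $A$ at the point $F$, and join $F$ to $C$. Then $\triangle FBC$ is the maximum generalized golden right triangle $T_2$, that is, a right triangle with sides $BC=1$, $BF=\sqrt{2\phi}$, $FC=\phi\sqrt{\phi}$.
   Context: $XY$ denotes the length of the segment with endpoints $X$ and $Y$. A Kepler triangle here is a right triangle with side lengths $1,\sqrt{\phi},\phi$. The maximum generalized golden right triangle $T_2$ is the right triangle with side lengths $(1,\sqrt{2\phi},\phi\sqrt{\phi})$. *)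

(* Defs.v *)
From HB Require Import structures.
From mathcomp Require Import all_boot all_order all_algebra reals.

Set Implicit Arguments.
Unset Strict Implicit.
Unset Printing Implicit Defensive.

Import Order.TTheory GRing.Theory Num.Theory.
Local Open Scope ring_scope.

Definition golden_ratio (R : realType) : R := (1 + Num.sqrt 5) / 2.

Definition point (R : realType) : Type := 'rV[R]_2.

Definition dot (R : realType) (u v : 'rV[R]_2) : R := \sum_i u 0 i * v 0 i.

(* Euclidean distance; the library norm on matrices is the sup norm. *)
Definition edist (R : realType) (P Q : point R) : R :=
  Num.sqrt (dot (Q - P) (Q - P)).

Definition on_line (R : realType) (P Q X : point R) : Prop :=
  exists t : R, X = P + t *: (Q - P).

Definition on_segment (R : realType) (P Q X : point R) : Prop :=
  exists t : R, 0 <= t <= 1 /\ X = P + t *: (Q - P).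

(* X lies on the line PQ, strictly beyond Q as seen from P. *)
Definition on_extension (R : realType) (P Q X : point R) : Prop :=
  exists t : R, 1 < t /\ X = P + t *: (Q - P).

Definition opposite_sides (R : realType) (P Q X Y : point R) : Prop :=
  [/\ ~ on_line P Q X, ~ on_line P Q Y
    & exists Z : point R, on_line P Q Z /\ on_segment X Y Z].

Definition triangle (R : realType) (A B C : point R) : Prop :=
  A <> B /\ ~ on_line A B C.

(* The angle PQS, with vertex Q, is defined and right. *)
Definition right_angle (R : realType) (P Q S : point R) : Prop :=
  [/\ P <> Q, S <> Q & dot (P - Q) (S - Q) = 0].

Definition right_triangle (R : realType) (A B C : point R) : Prop :=
  triangle A B C /\
  [\/ right_angle B A C, right_angle A B C | right_angle A C B].

(* The side lengths are given as a multiset: no correspondence between the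
   listed lengths and the sides is imposed. *)
Definition right_triangle_with_sides (R : realType) (s : seq R)
    (A B C : point R) : Prop :=
  right_triangle A B C /\ perm_eq [:: edist A B; edist B C; edist A C] s.

Definition kepler_triangle (R : realType) (A B C : point R) : Prop :=
  right_triangle_with_sides
    [:: 1; Num.sqrt (golden_ratio R); golden_ratio R] A B C.

Definition max_golden_right_triangle (R : realType) (A B C : point R) : Prop :=
  right_triangle_with_sides
    [:: 1; Num.sqrt (2 * golden_ratio R);
        golden_ratio R * Num.sqrt (golden_ratio R)] A B C.

(* P, Q, S, T are the vertices in cyclic order. *)
Definition square (R : realType) (P Q S T : point R) : Prop :=
  [/\ edist P Q = edist Q S, edist Q S = edist S T & edist S T = edist T P] /\
  [/\ right_angle T P Q, right_angle P Q S, right_angle Q S T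
    & right_angle S T P].

(* Main.v *)
Require Import Defs.
From HB Require Import structures.
From mathcomp Require Import all_boot all_order all_algebra reals.
From mathcomp Require Import ring lra.

Set Implicit Arguments.
Unset Strict Implicit.
Unset Printing Implicit Defensive.

Import Order.TTheory GRing.Theory Num.Theory.
Local Open Scope ring_scope.

(** The Kepler triangle can only be right-angled at [B], because the other two
    positions would give [phi + phi^2 = 1] or [phi^2 + 1 = phi]. The diagonal of
    the square satisfies [BE^2 = 2 AB^2 = 2 phi], and [F] lies on the line [AB],
    so [FBC] is right-angled at [B] too and
    [FC^2 = 2 phi + 1 = phi + phi^2 = phi^3]. *)

Section Geometry.
Variable R : realType.
Implicit Types (u v w : 'rV[R]_2) (P Q S : point R).

Lemma dotC u v : dot u v = dot v u.
Proof. by apply: eq_bigr => i _; rewrite mulrC. Qed.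

Lemma dotDl u v w : dot (u + v) w = dot u w + dot v w.
Proof. by rewrite -big_split; apply: eq_bigr => i _; rewrite mxE mulrDl. Qed.

Lemma dotZl (a : R) u v : dot (a *: u) v = a * dot u v.
Proof. by rewrite /dot mulr_sumr; apply: eq_bigr => i _; rewrite mxE mulrA. Qed.

Lemma dotNl u v : dot (- u) v = - dot u v.
Proof. by rewrite -scaleN1r dotZl mulN1r. Qed.

Lemma dotBB u v : dot (u - v) (u - v) = dot u u + dot v v - 2 * dot u v.
Proof.
rewrite dotDl dotNl !(dotC _ (u - v)) !dotDl !dotNl (dotC v u); ring.
Qed.

Lemma dot_ge0 u : 0 <= dot u u.
Proof. by apply: sumr_ge0 => i _; rewrite -expr2 sqr_ge0. Qed.

Lemma edist_ge0 P Q : 0 <= edist P Q.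
Proof. exact: sqrtr_ge0. Qed.

Lemma edist_sqr P Q : edist P Q ^+ 2 = dot (Q - P) (Q - P).
Proof. by rewrite sqr_sqrtr ?dot_ge0. Qed.

Lemma edistC P Q : edist P Q = edist Q P.
Proof.
by rewrite /edist -(opprB P Q) dotNl dotC dotNl opprK.
Qed.

Lemma edistxx P : edist P P = 0.
Proof. by rewrite /edist subrr -(scale0r (0 : 'rV_2)) dotZl mul0r sqrtr0. Qed.

Lemma edist_neq P Q : edist P Q != 0 -> P <> Q.
Proof. by move=> PQ0 eqPQ; rewrite eqPQ edistxx eqxx in PQ0. Qed.

(** Lengths are compared through their squares, which leaves only polynomial identities in the
    golden ratio. *)
Lemma edist_eqP P Q (a : R) : 0 <= a -> edist P Q ^+ 2 = a ^+ 2 -> edist P Q = a.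
Proof. by move=> a0 /eqP; rewrite eqrXn2 ?edist_ge0 // => /eqP. Qed.

Lemma pythagoras P Q S :
  dot (P - Q) (S - Q) = 0 -> edist P S ^+ 2 = edist P Q ^+ 2 + edist Q S ^+ 2.
Proof.
move=> PQS; rewrite (edistC P Q) !edist_sqr.
have -> : S - P = (S - Q) - (P - Q) by rewrite opprB addrA subrK.
by rewrite dotBB (dotC (S - Q)) PQS; ring.
Qed.

(** If [S] lay on the line [PQ], then [S - Q] would be both parallel and orthogonal to [P - Q],
    hence zero, against [S <> Q]. *)
Lemma right_angle_right_triangle P Q S :
  right_angle P Q S -> right_triangle P Q S.
Proof.
move=> [PQ SQ PQS]; split; last by apply: Or32; split.
split=> // -[t St]; apply: SQ; apply/eqP; rewrite -subr_eq0.
have SQE : S - Q = (1 - t) *: (P - Q).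
  by rewrite St -(opprB P Q) scalerN scalerBl scale1r addrAC.
have : dot (S - Q) (S - Q) = 0 by rewrite {1}SQE dotZl PQS mulr0.
(* A vanishing sum of squares forces every coordinate of [S - Q] to vanish. *)
move=> /eqP; rewrite psumr_eq0 => [/allP S0|i _]; last by rewrite -expr2 sqr_ge0.
apply/eqP/rowP => i; rewrite [RHS]mxE; apply/eqP.
by have := S0 i (mem_index_enum i); rewrite /= mulf_eq0 orbb.
Qed.

Lemma golden_ratio_gt1 : 1 < golden_ratio R.
Proof.
have : 1 < Num.sqrt (5 : R) by rewrite -[ltLHS]sqrtr1 ltr_sqrt; lra.
rewrite /golden_ratio; lra.
Qed.

Lemma golden_ratio_sqr : golden_ratio R ^+ 2 = golden_ratio R + 1.
Proof.
have : Num.sqrt (5 : R) ^+ 2 = 5 by rewrite sqr_sqrtr; lra.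
rewrite /golden_ratio; lra.
Qed.

(** [kepler_triangle] fixes neither the vertex of the right angle nor which side has which length;
    the two given lengths settle both. *)
Lemma kepler_right_angle P Q S :
    kepler_triangle P Q S -> edist Q S = 1 ->
    edist P Q = Num.sqrt (golden_ratio R) ->
  dot (P - Q) (S - Q) = 0.
Proof.
move=> [[_ right] sides] QS PQ.
have phi1 := golden_ratio_gt1; have phi2 := golden_ratio_sqr.
have PQ2 : edist P Q ^+ 2 = golden_ratio R by rewrite PQ sqr_sqrtr; lra.
have PS : edist P S = golden_ratio R.
  move: sides; rewrite PQ QS.
  (* Swapping the first two lengths aligns the lists; cancelling [1] and the square root leaves
     [edist P S] against the golden ratio. *)
  rewrite (perm_catCA [:: _] [:: _] [:: _]) /= !perm_cons.
  by move=> /perm_mem/(_ (golden_ratio R)); rewrite !inE eqxx => /eqP ->.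
case: right => -[_ _ // /pythagoras].
- by rewrite QS (edistC Q P) PQ2 PS phi2; lra.
- by rewrite PQ2 PS (edistC S Q) QS phi2; lra.
Qed.

End Geometry.

Theorem mainTheorem3 (R : realType) (A B C D E F : point R)
    (hABC : kepler_triangle A B C)
    (hBC : edist B C = 1)
    (hAB : edist A B = Num.sqrt (golden_ratio R))
    (hsquare : square A B D E)
    (hD : opposite_sides A B C D)
    (hE : opposite_sides A B C E)
    (hFray : on_extension B A F)
    (hFarc : edist B F = edist B E) :
  max_golden_right_triangle F B C /\
  [/\ edist B C = 1,
      edist B F = Num.sqrt (2 * golden_ratio R)
    & edist F C = golden_ratio R * Num.sqrt (golden_ratio R)].
Proof.
have phi1 := golden_ratio_gt1 R; have phi2 := golden_ratio_sqr R.
have phi_ge0 : 0 <= golden_ratio R by lra.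
have ABC := kepler_right_angle hABC hBC hAB.
have BF : edist B F = Num.sqrt (2 * golden_ratio R).
  apply: edist_eqP; first exact: sqrtr_ge0.
  (* Pythagoras in the half square [EAB], right-angled at [A]; the chain of equal sides turns [EA]
     into [AB]. *)
  case: hsquare => -[AB_BD BD_DE DE_EA] [[_ _ /pythagoras EB] _ _ _].
  rewrite hFarc edistC EB -DE_EA -BD_DE -AB_BD hAB !sqr_sqrtr //; lra.
have FBC : dot (F - B) (C - B) = 0.
  (* [F - B] is [t *: (A - B)], so it inherits orthogonality to [C - B]. *)
  by case: hFray => t [_ ->]; rewrite addrC addKr dotZl ABC mulr0.
have FC : edist F C = golden_ratio R * Num.sqrt (golden_ratio R).
  apply: edist_eqP; first by rewrite mulr_ge0 ?sqrtr_ge0.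
  rewrite (pythagoras FBC) (edistC F B) BF hBC exprMn !sqr_sqrtr //; last by lra.
  (* The goal is now [2 phi + 1 = (phi + 1) phi], and [phi2] applies once more to the product on the
     right. *)
  by rewrite phi2; lra.
split; last by split.
split; last first.
  rewrite (edistC F B) BF hBC FC.
  by rewrite (perm_catCA [:: _] [:: _] [:: _]).
(* What remains is that [F] and [C] differ from [B], which follows from the nonzero lengths [BF] and
   [BC]. *)
apply: right_angle_right_triangle; split=> //; apply: edist_neq.
- by rewrite edistC BF sqrtr_eq0 -ltNge; lra.
- by rewrite edistC hBC oner_neq0.
Qed.
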